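(* Let $a,b,c\ge 0$, $r,s\in[-1,1]$, and $\tau\in\mathcal S_0^3$. Then $$\tau(a)-\tau(c)-\tau\!\left(\sqrt{a^2-2rab+b^2}\right)+\tau\!\left(\sqrt{c^2-2scb+b^2}\right)\le 2b\,\tau'\!\left(\max(ra-sc,\,|a-c|)\right).$$
   Context: $\mathcal S$ is the set of nondecreasing, convex functions $\tau\colon[0,\infty)\to\mathbb R$ that are differentiable on $(0,\infty)$ with concave derivative $\tau'$; $\tau'$ is extended to $0$ by $\tau'(0):=\lim_{x\searrow0}\tau'(x)$. $\mathcal S_0^3$ is the set of $\tau\in\mathcal S$ with $\tau(0)=0$ that are three times continuously differentiable on $[0,\infty)$, where derivatives at $0$ are right derivatives. *)

(* Defs.v *)
From HB Require Import structures.
From mathcomp Require Import all_boot all_order all_algebra.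
From mathcomp Require Import all_classical all_reals all_analysis.

Set Implicit Arguments.
Unset Strict Implicit.
Unset Printing Implicit Defensive.

Import Order.TTheory GRing.Theory Num.Theory.
Import numFieldNormedType.Exports.

Local Open Scope classical_set_scope.
Local Open Scope ring_scope.

(* A function [0, +oo) -> R is represented by a total
   function R -> R; every notion below depends only on its values on
   [0, +oo). *)

Definition concave_function (R : realType) (D : set R) (f : R -> R) : Prop :=
  convex_function (D : set R^o) (fun x => - f x).

Record inS (R : realType) (tau : R -> R) : Prop := InS {
  inS_nondecreasing : {in `[0, +oo[ &, {homo tau : x y / x <= y}};
  inS_convex : convex_function (`[0, +oo[%classic : set R^o) tau;
  inS_derivable : {in `]0, +oo[, forall x, derivable tau x 1};
  inS_concave_derive : concave_function `]0, +oo[%classic (derive1 tau)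
}.

(* The derivative on ]0, +oo[, extended to 0 by its limit there; for tau in
   the class [inS] this limit exists, because derive1 tau is nondecreasing and
   nonnegative on ]0, +oo[. *)
Definition ext_derive (R : realType) (tau : R -> R) (x : R) : R :=
  if x == 0 then lim (derive1 tau y @[y --> 0^'+]) else derive1 tau x.

(* Differentiation on the half-line [0, +oo): two-sided at x > 0, from the
   right at 0 (the difference quotients at 0 only involve h > 0). *)
Definition hl_derivable (R : realType) (f : R -> R) (x : R) : Prop :=
  if x == 0 then cvg (h^-1 * (f h - f 0) @[h --> 0^'+])
  else derivable f x 1.

Definition hl_derive (R : realType) (f : R -> R) (x : R) : R :=
  if x == 0 then lim (h^-1 * (f h - f 0) @[h --> 0^'+])
  else derive1 f x.

Fixpoint hl_Ck (R : realType) (k : nat) (f : R -> R) : Prop :=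
  match k with
  | 0%N => {within `[0, +oo[, continuous f}
  | k'.+1 => {in `[0, +oo[, forall x, hl_derivable f x} /\
             hl_Ck k' (hl_derive f)
  end.

Record inS03 (R : realType) (tau : R -> R) : Prop := InS03 {
  inS03_inS : inS tau;
  inS03_0 : tau 0 = 0;
  inS03_C3 : hl_Ck 3 tau
}.

(* Main.v *)
Require Import Defs.
From HB Require Import structures.
From mathcomp Require Import all_boot all_order all_algebra.
From mathcomp Require Import all_classical all_reals all_analysis.
From mathcomp Require Import ring lra.
Set Implicit Arguments.
Unset Strict Implicit.
Unset Printing Implicit Defensive.
Import Order.TTheory GRing.Theory Num.Theory.
Import numFieldNormedType.Exports.
Local Open Scope ring_scope.
Local Open Scope classical_set_scope.

(** Write f for the derivative of tau, a' and c' for the two square roots,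
    M = max (ra - sc, |a - c|) and d = |a - c|.

    When a <= c, so that c = a + d, the left-hand side regroups as
      (G a' - G a) + (tau c' - tau (a' + d)),   G x = tau (x + d) - tau x,
    that is, the side c' is compared with the side a' + d that it would have if
    adding d commuted with passing from a to a'.  When c <= a, it regroups as
      (G c - G c') + (tau (c' + d) - tau a').
    Both have the shape (G P - G Q) + (tau q - tau p), and two facts on
    (P, Q, p, q) suffice.  The triangle inequality gives |P - Q| <= b and
    q - p <= b - (P - Q); the law of cosines gives the identity
    a^2 - a'^2 - c^2 + c'^2 = 2 b (ra - sc), hence
    q^2 - p^2 <= 2 b M - 2 (P - Q) d.

    The increment of G is controlled by concavity of f: G is nondecreasing as f
    is, and G' = f (x + d) - f x <= f M by subadditivity of f and d <= M
    ([inS_increment_ndecr], [inS_increment_growth]).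

    The other difference is controlled by [inS_secant_le]: if q - p <= B and
    q^2 - p^2 <= 2 B M, then tau q - tau p <= B f M.  This holds for tau = x
    and tau = x^2 by assumption.  In general f lies below a line
    f M + k (y - M) with 0 <= k and k M <= f M, so tau grows at most like a
    nonnegative combination of x and x^2.

    If P <= Q, the increment of G is nonpositive and the secant bound holds with
    B = 2 b; if Q <= P, the increment is at most (P - Q) f M <= b f M and the
    secant bound holds with B = b.  Either way the total is at most 2 b f M.

    The case M = 0 forces a = c and c' <= a', where monotonicity is enough. *)

(** * Concave functions on the open half-line *)

Lemma convex_chord (R : realType) (D : set R) (g : R -> R) (x y z : R) :
  convex_function (D : set R^o) g -> D x -> D z -> x <= y -> y <= z ->
  (z - x) * g y <= (z - y) * g x + (y - x) * g z.
Proof.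
move=> cg Dx Dz xy yz.
have [zx|xz] := leP z x.
  have -> : y = x by apply/le_anti; rewrite xy (le_trans yz).
  have -> : z = x by apply/le_anti; rewrite zx (le_trans xy).
  by rewrite !subrr !mul0r addr0.
have zx0 : 0 < z - x by rewrite subr_gt0.
(* y is the convex combination of x and z with weight (z - y) / (z - x) on x. *)
have t0 : 0 <= (z - y) / (z - x) by rewrite divr_ge0 ?subr_ge0 ?(ltW xz).
have t1 : (z - y) / (z - x) <= 1 by rewrite ler_pdivrMr// mul1r; lra.
have := cg (Itv01 t0 t1) x z; rewrite !inE => /(_ Dx Dz).
rewrite convRE [X in g X]convRE /= /unstable.onem.
have -> : (z - y) / (z - x) * x + (1 - (z - y) / (z - x)) * z = y.
  by field; rewrite gt_eqF.
rewrite -(ler_pM2l zx0) => /le_trans; apply.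
by rewrite le_eqVlt; apply/orP; left; apply/eqP; field; rewrite gt_eqF.
Qed.

Lemma concave_chord (R : realType) (g : R -> R) (x y z : R) :
  concave_function `]0, +oo[ g -> 0 < x -> x <= y -> y <= z ->
  (z - y) * g x + (y - x) * g z <= (z - x) * g y.
Proof.
move=> cg x0 xy yz.
have h (u : R) : 0 < u -> `]0, +oo[%classic u by rewrite /= in_itv/= andbT.
have := convex_chord cg (h _ x0) (h _ (lt_le_trans x0 (le_trans xy yz))) xy yz.
lra.
Qed.

(** Passing to the limit e -> 0; a concave function on the open half-line is
    tested near 0 and near +oo in this way, without any continuity. *)
Lemma le0_of_linear_ub (R : realType) (u v w : R) : 0 < w ->
  (forall e, 0 < e -> e < w -> u <= e * v) -> u <= 0.
Proof.
move=> w0 h; rewrite leNgt; apply/negP => u0.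
(* The second bound makes e * v smaller than u / 2. *)
pose e := Num.min (w / 2) (u / (2 * (`|v| + 1))).
have v1 : 0 < 2 * (`|v| + 1) by rewrite mulr_gt0// ltr_wpDl.
have e0 : 0 < e by rewrite lt_min !divr_gt0.
have ew : e < w.
  by rewrite gt_min ltr_pdivrMr// ltr_pMr// ltr1n.
have : e * (2 * (`|v| + 1)) <= u.
  by rewrite -ler_pdivlMr// ge_min lexx orbT.
have := h _ e0 ew.
have := ler_wpM2l (ltW e0) (ler_norm v).
nra.
Qed.

(** If g decreased somewhere, the chord through a decreasing pair would push it
    below 0 far to the right; the far point used here is y + 1 / e. *)
Lemma concave_ge0_ndecr (R : realType) (g : R -> R) (x y : R) :
  concave_function `]0, +oo[ g -> (forall u, 0 < u -> 0 <= g u) ->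
  0 < x -> x <= y -> g x <= g y.
Proof.
move=> cg g0 x0 xy; rewrite -subr_le0.
apply: (@le0_of_linear_ub _ _ ((y - x) * g y) 1) => // e e0 _.
have y0 : 0 < y by exact: lt_le_trans xy.
have ie0 : 0 < e^-1 by rewrite invr_gt0.
rewrite -(ler_pM2l ie0) mulrA mulVf ?gt_eqF// mul1r.
have yz : y <= y + e^-1 by rewrite lerDl ltW.
have := concave_chord cg x0 xy yz.
have := mulr_ge0 (eqbRL (subr_ge0 _ _) xy) (g0 _ (lt_le_trans y0 yz)).
lra.
Qed.

(** [g u / u] is nonincreasing: compare g at x with the chord from (e, g e),
    where g e >= 0, to (y, g y), and let e tend to 0. *)
Lemma concave_ge0_ratio (R : realType) (g : R -> R) (x y : R) :
  concave_function `]0, +oo[ g -> (forall u, 0 < u -> 0 <= g u) ->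
  0 < x -> x <= y -> x * g y <= y * g x.
Proof.
move=> cg g0 x0 xy; rewrite -subr_le0.
apply: (@le0_of_linear_ub _ _ (g y - g x) x) => // e e0 ex.
have := concave_chord cg e0 (ltW ex) xy.
have := mulr_ge0 (eqbRL (subr_ge0 _ _) xy) (g0 _ e0).
lra.
Qed.

Lemma concave_ge0_subadd (R : realType) (g : R -> R) (x y : R) :
  concave_function `]0, +oo[ g -> (forall u, 0 < u -> 0 <= g u) ->
  0 < x -> 0 < y -> g (x + y) <= g x + g y.
Proof.
move=> cg g0 x0 y0; have xy0 : 0 < x + y by rewrite addr_gt0.
rewrite -(ler_pM2l xy0).
have hx : x <= x + y by lra.
have hy : y <= x + y by lra.
have := concave_ge0_ratio cg g0 x0 hx.
have := concave_ge0_ratio cg g0 y0 hy.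
lra.
Qed.

(** The slope k is the right derivative at M, obtained as a supremum of slopes;
    the bound on [k * M] says that the supporting line is nonnegative at 0, which
    is what makes k usable together with [g M] alone. *)
Lemma concave_ge0_supergradient (R : realType) (g : R -> R) (M : R) :
  concave_function `]0, +oo[ g -> (forall u, 0 < u -> 0 <= g u) -> 0 < M ->
  exists k, [/\ 0 <= k, k * M <= g M &
    forall y, 0 < y -> g y <= g M + k * (y - M)].
Proof.
move=> cg g0 M0.
pose E := [set (g y - g M) / (y - M) | y in [set y | M < y]].
have E0 : E !=set0 by exists ((g (M + 1) - g M) / (M + 1 - M)), (M + 1) => //=; lra.
have slope z : 0 < z -> z < M -> ubound E ((g M - g z) / (M - z)).
  move=> z0 zM _ [y /= My <-].
  rewrite ler_pdivrMr ?subr_gt0// mulrAC ler_pdivlMr ?subr_gt0//.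
  have := concave_chord cg z0 (ltW zM) (ltW My).
  lra.
have M2 : 0 < M / 2 by rewrite divr_gt0.
have M2M : M / 2 < M by lra.
have ubE : has_ubound E by eexists; exact: (slope _ M2 M2M).
exists (sup E); split.
- have M1 : M < M + 1 by rewrite ltrDl.
  apply: le_trans (ub_le_sup ubE _); last by exists (M + 1).
  rewrite divr_ge0// subr_ge0 ?(ltW M1)//.
  exact: concave_ge0_ndecr (ltW M1).
- rewrite -ler_pdivlMr//; apply: ge_sup => // _ [y /= My <-].
  rewrite ler_pdivrMr ?subr_gt0// mulrAC ler_pdivlMr//.
  have := concave_ge0_ratio cg g0 M0 (ltW My).
  lra.
- move=> y y0; have [yM|My|->] := ltgtP y M.
  + have := ge_sup E0 (slope _ y0 yM).
    rewrite ler_pdivlMr ?subr_gt0//; lra.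
  + have : (g y - g M) / (y - M) <= sup E by apply: ub_le_sup => //; exists y.
    rewrite ler_pdivrMr ?subr_gt0//; lra.
  + by rewrite subrr mulr0 addr0.
Qed.

(** * Regularity and growth of functions in the class *)

Lemma inS_is_derive (R : realType) (tau : R -> R) (x : R) :
  inS tau -> 0 < x -> is_derive x 1 tau (derive1 tau x).
Proof.
move=> tauS x0; apply: DeriveDef; last by rewrite derive1E.
by apply: (inS_derivable tauS); rewrite in_itv/= andbT.
Qed.

Lemma inS_derive1_ge0 (R : realType) (tau : R -> R) (x : R) :
  inS tau -> 0 < x -> 0 <= derive1 tau x.
Proof.
move=> tauS x0; rewrite derive1E; apply: limr_ge.
  exact: (ex_derive (is_derive := inS_is_derive tauS x0)).
near=> h.
have hx : `|h| < x by near: h; apply: dnbhs0_lt.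
have xh : 0 < x + h.
  by move: hx; rewrite ltr_norml -ltrBlDl sub0r => /andP[].
have -> : (tau \o shift x) h%:A = tau (x + h).
  by rewrite /= /GRing.scale/= mulr1 addrC.
rewrite /GRing.scale/=.
have [h0|h0] := leP 0 h.
  rewrite mulr_ge0 ?invr_ge0// subr_ge0.
  by apply: (inS_nondecreasing tauS); rewrite ?in_itv/= ?andbT ?lerDl// ltW.
apply: mulr_le0; rewrite ?invr_le0 ?subr_le0 ?(ltW h0)//.
apply: (inS_nondecreasing tauS); rewrite ?in_itv/= ?andbT; last by rewrite gerDl ltW.
- exact: ltW xh.
- exact: ltW x0.
Unshelve. all: by end_near. Qed.

(** Convexity alone does not exclude a jump at 0; monotonicity does, by
    squeezing tau between the constant [tau 0] and the chord over [0, 1]. *)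
Lemma inS_continuous (R : realType) (tau : R -> R) :
  inS tau -> {within `[0, +oo[, continuous tau}.
Proof.
move=> tauS; apply/continuous_within_itvcyP; split.
  move=> x; rewrite in_itv/= andbT => x0.
  apply: differentiable_continuous; apply/derivable1_diffP.
  exact: (ex_derive (is_derive := inS_is_derive tauS x0)).
have pos (x : R) : 0 <= x -> `[0, +oo[%classic x by rewrite /= in_itv/= andbT.
apply: (@squeeze_cvgr _ _ _ _ (fun=> tau 0) (fun x => tau 0 + x * (tau 1 - tau 0))).
- near=> x.
  have x0 : 0 <= x by [].
  have x1 : x <= 1 by near: x; apply: nbhs_right_le.
  apply/andP; split.
    by apply: (inS_nondecreasing tauS); rewrite ?in_itv/= ?lexx ?x0.
  have := convex_chord (inS_convex tauS) (pos _ (lexx _)) (pos _ ler01) x0 x1.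
  lra.
- exact: cvg_cst.
- rewrite -[X in _ --> X]addr0 -[X in _ --> _ + X](mul0r (tau 1 - tau 0)).
  apply: cvgD; first exact: cvg_cst.
  apply: cvgMr_tmp; apply: cvg_at_right_filter; exact: cvg_id.
Unshelve. all: by end_near. Qed.

Lemma halfline_ndecr (R : realType) (F g : R -> R) (x y : R) :
  {within `[0, +oo[, continuous F} ->
  (forall u : R, 0 < u -> is_derive u 1 F (g u)) ->
  (forall u : R, 0 < u -> 0 <= g u) -> 0 <= x -> x <= y -> F x <= F y.
Proof.
move=> cF dF g0 x0 xy.
apply: (@ger0_derive1_ndecry _ _ 0) => // u; rewrite in_itv/= andbT => u0.
  exact: (ex_derive (is_derive := dF u u0)).
by rewrite derive1E (derive_val (is_derive := dF u u0)) g0.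
Qed.

Lemma is_derive_shift (R : realType) (F : R -> R) (d x l : R) :
  is_derive (x + d) 1 F l -> is_derive x 1 (fun u => F (u + d)) l.
Proof.
move=> dF; rewrite -[l]mulr1.
apply: (is_derive1_comp (g := fun u => u + d)) => //.
by apply: is_derive_eq; rewrite addr0.
Qed.

Lemma within_continuous_shift (R : realType) (F : R -> R) (d : R) : 0 <= d ->
  {within `[0, +oo[, continuous F} ->
  {within `[0, +oo[, continuous (fun x => F (x + d))}.
Proof.
rewrite le_eqVlt => /predU1P[<-|d0].
  by have -> : (fun x : R => F (x + 0)) = F by apply/funext => x; rewrite addr0.
move=> /continuous_within_itvcyP[cF _].
have cs (x : R) : 0 <= x -> {for x, continuous (fun x => F (x + d))}.
  move=> x0; apply: continuous_comp.
    by apply: continuousD; [exact: cvg_id|exact: cvg_cst].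
  by apply: cF; rewrite in_itv/= andbT ltr_wpDl.
apply: continuous_in_subspaceT => x.
by rewrite inE /= in_itv/= andbT => /cs.
Qed.

Lemma inS_increment_ndecr (R : realType) (tau : R -> R) (d x y : R) :
  inS tau -> 0 <= d -> 0 <= x -> x <= y ->
  tau (x + d) - tau x <= tau (y + d) - tau y.
Proof.
move=> tauS d0 x0 xy.
have f0 (u : R) : 0 < u -> 0 <= derive1 tau u by exact: inS_derive1_ge0.
apply: (@halfline_ndecr _ (fun u => tau (u + d) - tau u)
  (fun u => derive1 tau (u + d) - derive1 tau u) x y _ _ _ x0 xy).
- apply: within_continuousB; last exact: inS_continuous.
  exact/within_continuous_shift/inS_continuous.
- move=> u u0; apply: is_deriveB; last exact: inS_is_derive.
  by apply/is_derive_shift/inS_is_derive => //; rewrite ltr_pwDl.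
- move=> u u0; rewrite subr_ge0.
  by apply: concave_ge0_ndecr f0 _ _; rewrite ?lerDl//; exact: inS_concave_derive.
Qed.

(** The derivative of the increment, [f (u + d) - f u], is at most [f M] because
    f is nondecreasing and subadditive and d <= M. *)
Lemma inS_increment_growth (R : realType) (tau : R -> R) (d M x y : R) :
  inS tau -> 0 <= d -> d <= M -> 0 < M -> 0 <= x -> x <= y ->
  (tau (y + d) - tau y) - (tau (x + d) - tau x) <= (y - x) * derive1 tau M.
Proof.
move=> tauS d0 dM M0 x0 xy.
have f0 (u : R) : 0 < u -> 0 <= derive1 tau u by exact: inS_derive1_ge0.
have cf := inS_concave_derive tauS.
suff : derive1 tau M * x - (tau (x + d) - tau x) <=
       derive1 tau M * y - (tau (y + d) - tau y) by lra.
apply: (@halfline_ndecr _ (fun u => derive1 tau M * u - (tau (u + d) - tau u))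
  (fun u => derive1 tau M * 1 - (derive1 tau (u + d) - derive1 tau u)) x y _ _ _ x0 xy).
- apply: within_continuousB.
      apply: continuous_subspaceT => u; exact: mulrl_continuous.
    apply: within_continuousB; last exact: inS_continuous.
    exact/within_continuous_shift/inS_continuous.
  - move=> u u0; apply: is_deriveB.
    apply: is_deriveB; last exact: inS_is_derive.
    by apply/is_derive_shift/inS_is_derive => //; rewrite ltr_pwDl.
  - move=> u u0; have uM : u + d <= u + M by lra.
    have := concave_ge0_ndecr cf f0 (ltr_pwDl u0 d0) uM.
    have := concave_ge0_subadd cf f0 u0 M0.
    lra.
Qed.

(** The affine upper bound on the derivative, integrated from p to q. *)
Lemma inS_quadratic_upper_bound (R : realType) (tau : R -> R) (k M p q : R) :
  inS tau ->
  (forall u, 0 < u -> derive1 tau u <= derive1 tau M + k * (u - M)) ->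
  0 <= p -> p <= q ->
  tau q - tau p <=
    derive1 tau M * (q - p) + k * ((q ^+ 2 - p ^+ 2) / 2 - M * (q - p)).
Proof.
move=> tauS hk p0 pq.
pose F (u : R) := (derive1 tau M - k * M) * u + k / 2 * u ^+ 2.
suff : F p - tau p <= F q - tau q by rewrite /F; lra.
apply: (@halfline_ndecr _ (fun u => F u - tau u)
  (fun u => (derive1 tau M - k * M) * 1 + k / 2 * (u *+ 2) - derive1 tau u) p q _ _ _ p0 pq).
- apply: within_continuousB; last exact: inS_continuous.
  apply: continuous_subspaceT => u; apply: continuousD; first exact: mulrl_continuous.
  by apply: continuousM; [exact: cvg_cst|exact: exprn_continuous].
- move=> u u0; apply: is_deriveB; last exact: inS_is_derive.
  apply: is_deriveD.
  have dsq : is_derive u 1 (fun v : R => v ^+ 2) (u *+ 2).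
    by apply: is_derive_eq; rewrite /GRing.scale/= mulr1.
  exact: (is_deriveZ _ dsq).
- move=> u u0; have := hk u u0; lra.
Qed.

(** With the slope k of a supporting line at M, the quadratic bound is
    [f M * (q - p) + k * (B * M - M * (q - p))] at most; since k M <= f M and
    q - p <= B, replacing k M by f M turns it into [f M * B]. *)
Lemma inS_secant_le (R : realType) (tau : R -> R) (B M p q : R) :
  inS tau -> 0 < M -> 0 <= B -> 0 <= p -> 0 <= q -> q - p <= B ->
  q ^+ 2 - p ^+ 2 <= 2 * B * M -> tau q - tau p <= B * derive1 tau M.
Proof.
move=> tauS M0 B0 p0 q0 qp qp2.
have f0 (u : R) : 0 < u -> 0 <= derive1 tau u by exact: inS_derive1_ge0.
have [pq|/ltW qp'] := leP p q; last first.
  apply: (@le_trans _ _ 0); last by rewrite mulr_ge0// f0.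
  by rewrite subr_le0; apply: (inS_nondecreasing tauS); rewrite ?in_itv/= ?andbT.
have [k [k0 kM hk]] := concave_ge0_supergradient (inS_concave_derive tauS) f0 M0.
apply: le_trans (inS_quadratic_upper_bound tauS hk p0 pq) _.
have qpM : (q ^+ 2 - p ^+ 2) / 2 - M * (q - p) <= M * (B - (q - p)) by lra.
have := ler_wpM2l k0 qpM.
have := ler_wpM2r (eqbRL (subr_ge0 _ _) qp) kM.
lra.
Qed.

(** The two ways in which the quadruple difference regroups are both instances
    of this inequality; the sign of P - Q decides how the budget 2 b is shared
    between the increment of [u |-> tau (u + d) - tau u] and the secant from p
    to q. *)
Lemma inS_shifted_difference_le (R : realType) (tau : R -> R) (b d M P Q p q : R) :
  inS tau -> 0 < M -> 0 <= P -> 0 <= Q -> 0 <= p -> 0 <= q -> 0 <= d -> d <= M ->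
  `|P - Q| <= b -> q - p <= b - (P - Q) ->
  q ^+ 2 - p ^+ 2 <= 2 * b * M - 2 * (P - Q) * d ->
  (tau (P + d) - tau P) - (tau (Q + d) - tau Q) + (tau q - tau p)
    <= 2 * b * derive1 tau M.
Proof.
move=> tauS M0 P0 Q0 p0 q0 d0 dM; rewrite ler_norml => /andP[PQ1 PQ2] qp qp2.
have fM : 0 <= derive1 tau M by exact: inS_derive1_ge0.
have b0 : 0 <= b by lra.
have b2_0 : 0 <= 2 * b by lra.
have [PQ|/ltW QP] := leP P Q.
- have := inS_increment_ndecr tauS d0 P0 PQ.
  have qp2b : q - p <= 2 * b by lra.
  have qp2bM : q ^+ 2 - p ^+ 2 <= 2 * (2 * b) * M.
    have : (Q - P) * d <= b * M by apply: ler_pM; lra.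
    lra.
  have := inS_secant_le tauS M0 b2_0 p0 q0 qp2b qp2bM.
  lra.
- have := inS_increment_growth tauS d0 dM M0 Q0 QP.
  have qpb : q - p <= b by lra.
  have qp2b : q ^+ 2 - p ^+ 2 <= 2 * b * M.
    have : 0 <= (P - Q) * d by rewrite mulr_ge0 ?subr_ge0.
    lra.
  have := inS_secant_le tauS M0 b0 p0 q0 qpb qp2b.
  have := ler_wpM2r fM PQ2.
  lra.
Qed.

Lemma ext_derive_ge0 (R : realType) (tau : R -> R) (x : R) :
  inS tau -> 0 <= x -> 0 <= ext_derive tau x.
Proof.
move=> tauS; rewrite /ext_derive le_eqVlt eq_sym => /predU1P[->|x0]; last first.
  by rewrite gt_eqF// inS_derive1_ge0.
have f0 (u : R) : 0 < u -> 0 <= derive1 tau u by exact: inS_derive1_ge0.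
rewrite eqxx; apply: limr_ge.
  apply: nondecreasing_at_right_is_cvgr; near=> z.
    move=> u v; rewrite !in_itv/= => /andP[u0 _] _ uv.
    exact: concave_ge0_ndecr (inS_concave_derive tauS) f0 u0 uv.
  by exists 0 => _ [u /= + <-]; rewrite in_itv/= => /andP[u0 _]; apply: f0.
by near=> z; apply: f0.
Unshelve. all: by end_near. Qed.

(** * The inequality for the four distances *)

(** The law of cosines and the triangle inequality, for the triangle with sides
    a and b whose angle has cosine r. *)
Lemma third_side_bounds (R : realType) (a b r : R) :
  0 <= a -> 0 <= b -> -1 <= r <= 1 ->
  let a' := Num.sqrt (a ^+ 2 - 2 * r * a * b + b ^+ 2) in
  a' ^+ 2 = a ^+ 2 - 2 * r * a * b + b ^+ 2 /\ `|a' - a| <= b.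
Proof.
move=> a0 b0 /andP[r1 r2] a'.
have ab0 : 0 <= a * b by rewrite mulr_ge0.
have rab1 : r * (a * b) <= a * b by rewrite ler_piMl.
have rab2 : - (a * b) <= r * (a * b).
  by rewrite -mulN1r ler_wpM2r.
have a'2 : a' ^+ 2 = a ^+ 2 - 2 * r * a * b + b ^+ 2.
  rewrite sqr_sqrtr//; have := sqr_ge0 (a - b); lra.
have a'0 : 0 <= a' by exact: sqrtr_ge0.
split=> //; rewrite ler_norml; apply/andP; split.
- have [?|ab] := leP (a - b) 0; first lra.
  suff : a - b <= a' by lra.
  rewrite -ler_sqr ?nnegrE ?(ltW ab)//; lra.
- suff : a' <= a + b by lra.
  rewrite -ler_sqr ?nnegrE ?addr_ge0//; lra.
Qed.

Theorem theorem21 (R : realType) (a b c r s : R) (tau : R -> R)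
    (a_ge0 : 0 <= a) (b_ge0 : 0 <= b) (c_ge0 : 0 <= c)
    (r_itv : -1 <= r <= 1) (s_itv : -1 <= s <= 1)
    (tauS : inS03 tau) :
  tau a - tau c
    - tau (Num.sqrt (a ^+ 2 - 2 * r * a * b + b ^+ 2))
    + tau (Num.sqrt (c ^+ 2 - 2 * s * c * b + b ^+ 2))
  <= 2 * b * ext_derive tau (Num.max (r * a - s * c) `|a - c|).
Proof.
have {}tauS := inS03_inS tauS.
have := third_side_bounds a_ge0 b_ge0 r_itv.
have := third_side_bounds c_ge0 b_ge0 s_itv.
have a'_ge0 := sqrtr_ge0 (a ^+ 2 - 2 * r * a * b + b ^+ 2).
have c'_ge0 := sqrtr_ge0 (c ^+ 2 - 2 * s * c * b + b ^+ 2).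
set c' := Num.sqrt (c ^+ 2 - _ + _) in c'_ge0 *.
set a' := Num.sqrt (a ^+ 2 - _ + _) in a'_ge0 *.
move=> /= [c'2 c'c] [a'2 a'a].
set M := Num.max _ _.
have uM : r * a - s * c <= M by rewrite le_max lexx.
have dM : `|a - c| <= M by rewrite le_max lexx orbT.
have ubM : b * (r * a - s * c) <= b * M by rewrite ler_wpM2l.
have [M_gt0|M_le0] := ltP 0 M; last first.
  (* M = 0: here a = c, and ra - sc <= 0 gives c' <= a'. *)
  have ac : a = c by apply/eqP; rewrite -subr_eq0 -normr_le0 (le_trans dM).
  apply: (@le_trans _ _ 0); last first.
    rewrite !mulr_ge0// ext_derive_ge0//.
    exact: le_trans (normr_ge0 _) dM.
  rewrite ac subrr sub0r addrC subr_le0.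
  apply: (inS_nondecreasing tauS); rewrite ?in_itv/= ?andbT//.
  rewrite -ler_sqr ?nnegrE// a'2 c'2 ac.
  have : b * M <= 0 by rewrite mulr_ge0_le0.
  rewrite ac in ubM *; lra.
rewrite /ext_derive gt_eqF//.
move: dM c'c a'a; rewrite !ler_norml => /andP[dM1 dM2] /andP[c'c1 c'c2] /andP[a'a1 a'a2].
have [ac|/ltW ca] := leP a c.
- have d0 : 0 <= c - a by rewrite subr_ge0.
  have aca : a + (c - a) = c by rewrite addrC subrK.
  have : (tau (a' + (c - a)) - tau a') - (tau (a + (c - a)) - tau a)
         + (tau c' - tau (a' + (c - a))) <= 2 * b * derive1 tau M.
    apply: inS_shifted_difference_le => //; rewrite ?ler_norml; lra.
  rewrite aca; lra.
- have d0 : 0 <= a - c by rewrite subr_ge0.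
  have cac : c + (a - c) = a by rewrite addrC subrK.
  have : (tau (c + (a - c)) - tau c) - (tau (c' + (a - c)) - tau c')
         + (tau (c' + (a - c)) - tau a') <= 2 * b * derive1 tau M.
    apply: inS_shifted_difference_le => //; rewrite ?ler_norml; lra.
  rewrite cac; lra.
Qed.
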